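(* Let positive integers $n\ge1$ and $m,d,\ell\le n$ be given. Suppose $A:\binom{[n]}{m}\to\mathbb{R}^{p\times p}$ and $B:\{0,1\}^n\to\mathbb{R}^{p\times p}$ take symmetric matrices as values, $D:\{0,1\}^m\to\mathbb{R}$ is a degree-$d$ pseudo-density, and $\deg(B)\le\ell$. Then $$\mathbb E_{S,x}D(x_S)\|A(S)B(x)\|_F^2\ge-2\|D\|_\infty\left(\frac{\ell m}{n-m}\right)^{d/4}\left(\max_S\|A(S)^2\|\right)^{1/2}\left(\mathbb E_{S,x}\|A(S)B(x)\|_F^2\right)^{1/2}\left(\mathbb E_x\|B(x)\|_F^2\right)^{1/2}.$$
   Context: Expectations are over $S$ uniform among $m$-element subsets of $[n]$ and $x$ uniform in $\{0,1\}^n$. For $S=\{i_1<\dots<i_m\}$, $x_S=(x_{i_1},\dots,x_{i_m})$. The degree of a function on the cube is the degree of its unique multilinear polynomial representation; for a matrix-valued function it is the maximum degree of its entries. A degree-$d$ pseudo-density is $D:\{0,1\}^m\to\mathbb{R}$ with $\mathbb E_xD(x)=1$ and $\mathbb E_xD(x)g(x)^2\ge0$ for every $g$ of degree at most $d/2$; $\|D\|_\infty=\max_x|D(x)|$. $\|\cdot\|_F$ is the Frobenius norm and $\|\cdot\|$ the operator norm.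
   Formalization: The formal theorem assumes m < n instead of m ≤ n, because the factor ℓm/(n−m) in the bound is undefined (division by zero) when m = n. *)

(* Defs.v *)
From HB Require Import structures.
From mathcomp Require Import all_boot all_order all_algebra.
From mathcomp Require Import all_classical all_reals all_analysis.

Set Implicit Arguments.
Unset Strict Implicit.
Unset Printing Implicit Defensive.

Import Order.TTheory GRing.Theory Num.Theory.

Local Open Scope ring_scope.

Definition cube (n : nat) := {ffun 'I_n -> bool}.

Definition msubset (n m : nat) := {S : {set 'I_n} | #|S| == m}.

Definition Ex (R : realType) (T : finType) (f : T -> R) : R :=
  (\sum_(t : T) f t) / #|T|%:R.

Definition msubset_elt (n m : nat) (S : msubset n m) (k : 'I_m) : 'I_n :=
  enum_val (cast_ord (esym (eqP (valP S))) k).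

Lemma msubset_elt_increasing (n m : nat) (S : msubset n m) (j k : 'I_m) :
  (j < k)%N -> (msubset_elt S j < msubset_elt S k)%N.
Proof.
move=> jk; rewrite /msubset_elt; set j' := cast_ord _ j; set k' := cast_ord _ k.
have srt : sorted ltn (map val (enum (val S))).
  rewrite -[enum _](eq_filter (mem_enum _)).
  rewrite -(eq_filter (mem_map val_inj _)) -filter_map.
  by rewrite (sorted_filter ltn_trans) // unlock val_ord_enum iota_ltn_sorted.
have e (i : 'I_#|val S|) : val (enum_val i) = nth 0%N (map val (enum (val S))) i.
  by have x0 := enum_val i; rewrite (nth_map x0) -?cardE // -enum_val_nth.
rewrite !e; apply: (sorted_ltn_nth ltn_trans) => //;
  by rewrite inE size_map -cardE.
Qed.

Definition restr (n m : nat) (x : cube n) (S : msubset n m) : cube m :=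
  [ffun k : 'I_m => x (msubset_elt S k)].

(* c is the coefficient family of the multilinear polynomial
   \sum_T c_T \prod_(i in T) x_i. *)
Definition multilinear_repr (R : realType) (n : nat) (f : cube n -> R)
    (c : {ffun {set 'I_n} -> R}) : Prop :=
  forall x : cube n,
    f x = \sum_(T : {set 'I_n}) c T * \prod_(i in T) (x i)%:R.

Lemma multilinear_repr_exists (R : realType) (n : nat) (f : cube n -> R) :
  exists c, multilinear_repr f c.
Proof.
pose s (y : cube n) (J : {set 'I_n}) : R :=
  \prod_i (if i \in J then (if y i then 1 else -1) else (~~ y i)%:R).
exists [ffun J => \sum_y f y * s y J] => x.
under eq_bigr do rewrite ffunE big_distrl /=.
rewrite exchange_big /=.
have sE y : \sum_(J : {set 'I_n}) s y J * \prod_(i in J) (x i)%:R = (x == y)%:R.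
  under eq_bigr => J _ do rewrite [\prod_(i in J) _]big_mkcond /= -big_split /=.
  transitivity (\prod_i ((if y i then 1 else -1) * (x i)%:R + (~~ y i)%:R : R)).
    rewrite bigA_distr; apply: eq_bigr => J _; apply: eq_bigr => i _.
    by case: ifP => // _; rewrite mulr1.
  have [->|/eqP nxy] := eqVneq x y.
    apply: big1 => i _; case: (y i) => /=; first by rewrite mulr1 addr0.
    by rewrite mulr0 add0r.
  have [i ni] : exists i, x i != y i.
    apply: contrapT => H; apply: nxy; apply/ffunP => i.
    by apply/eqP/negPn/negP => ni; apply: H; exists i.
  rewrite (bigD1 i) //=; move: ni; case: (x i); case: (y i) => //= _.
    by rewrite mulr1 addNr mul0r.
  by rewrite mulr0 addr0 mul0r.
transitivity (\sum_y f y * (x == y)%:R).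
  rewrite (bigD1 x) //= eqxx mulr1 big1 ?addr0 // => y nyx.
  by rewrite eq_sym (negbTE nyx) mulr0.
apply: eq_bigr => y _; rewrite -sE mulr_sumr.
by apply: eq_bigr => J _; rewrite mulrA.
Qed.

Lemma multilinear_repr_unique (R : realType) (n : nat) (f : cube n -> R)
    (c c' : {ffun {set 'I_n} -> R}) :
  multilinear_repr f c -> multilinear_repr f c' -> c = c'.
Proof.
move=> hc hc'; apply/ffunP => T.
have ev (e : {ffun {set 'I_n} -> R}) (V : {set 'I_n}) :
    \sum_(U : {set 'I_n}) e U * \prod_(i in U) ([ffun i => i \in V] i : bool)%:R
    = \sum_(U : {set 'I_n} | U \subset V) e U.
  rewrite [RHS]big_mkcond /=; apply: eq_bigr => U _.
  case: ifPn => [/fintype.subsetP sUV|/fintype.subsetPn[i iU niV]].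
    by rewrite big1 ?mulr1 // => i /sUV iV; rewrite ffunE iV.
  by rewrite (bigD1 i) //= ffunE (negbTE niV) mul0r mulr0.
have [k] := ubnP #|T|; elim: k T => // k IH T Tk.
have := hc [ffun i => i \in T]; rewrite (hc' [ffun i => i \in T]) !ev.
rewrite (bigD1 T) //= [in RHS](bigD1 T) //=.
rewrite (eq_bigr (fun U => c U)) => [/addIr //|U /andP[sUT nUT]].
rewrite IH //; apply: leq_trans (_ : #|T| <= k)%N => //.
by apply: proper_card; rewrite finset.properEneq nUT.
Qed.

Definition multilinear_coef (R : realType) (n : nat) (f : cube n -> R) :
    {ffun {set 'I_n} -> R} :=
  projT1 (cid (multilinear_repr_exists f)).

Definition cube_deg (R : realType) (n : nat) (f : cube n -> R) : nat :=
  \max_(T : {set 'I_n} | multilinear_coef f T != 0) #|T|.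

Definition mx_cube_deg (R : realType) (n p : nat) (B : cube n -> 'M[R]_p) : nat :=
  \max_(i < p) \max_(j < p) cube_deg (fun x => B x i j).

Definition pseudo_density (R : realType) (m d : nat) (D : cube m -> R) : Prop :=
  Ex D = 1 /\
  (forall g : cube m -> R,
     (cube_deg g)%:R <= d%:R / 2 :> R -> 0 <= Ex (fun x => D x * g x ^+ 2)).

Definition sup_norm (R : realType) (m : nat) (D : cube m -> R) : R :=
  \big[Num.max/0]_(x : cube m) `|D x|.

(* On column vectors this is the Euclidean norm. *)
Definition frobenius_norm (R : realType) (p q : nat) (M : 'M[R]_(p, q)) : R :=
  Num.sqrt (\sum_i \sum_j M i j ^+ 2).

Definition operator_norm (R : realType) (p q : nat) (M : 'M[R]_(p, q)) : R :=
  sup [set frobenius_norm (M *m v) | v in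
        [set v : 'cV[R]_q | frobenius_norm v <= 1]]%classic.

Lemma operator_norm_has_sup (R : realType) (p q : nat) (M : 'M[R]_(p, q)) :
  has_sup [set frobenius_norm (M *m v) | v in
            [set v : 'cV[R]_q | frobenius_norm v <= 1]]%classic.
Proof.
split.
  exists (frobenius_norm (M *m (0 : 'cV_q))); exists 0 => //=.
  rewrite /frobenius_norm big1 ?sqrtr0 // => i _.
  by rewrite big1 // => j _; rewrite mxE expr0n.
exists (Num.sqrt (\sum_i \sum_(j < 1) (\sum_k `|M i k|) ^+ 2)) => _ [v /= hv <-].
apply: ler_wsqrtr; apply: ler_sum => i _; apply: ler_sum => j _.
have v1 k : `|v k j| <= 1.
  apply: le_trans hv; rewrite -sqrtr_sqr; apply: ler_wsqrtr.
  rewrite (bigD1 k) //= (bigD1 j) //= -addrA lerDl addr_ge0 //.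
    by apply: sumr_ge0 => ? _; exact: sqr_ge0.
  by apply: sumr_ge0 => ? _; apply: sumr_ge0 => ? _; exact: sqr_ge0.
rewrite -[X in X <= _]real_normK ?num_real // lerXn2r ?nnegrE ?sumr_ge0 //.
rewrite mxE; apply: le_trans (ler_norm_sum _ _ _) _; apply: ler_sum => k _.
by rewrite normrM ler_piMr.
Qed.

(* Main.v *)
Require Import Defs.
From HB Require Import structures.
From mathcomp Require Import all_boot all_order all_algebra.
From mathcomp Require Import all_classical all_reals all_analysis.
From mathcomp Require Import lra zify.
Import Order.TTheory GRing.Theory Num.Theory.
Local Open Scope ring_scope.

(** Fix [S] and expand [B] in Walsh characters. Let [L] be the part of [A(S)B(x)]
    spanned by the characters [a] with [|a :&: S| <= d/2]. For fixed coordinates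
    outside [S] it has degree at most [d/2] in [x_S], so [E D(x_S)|L|^2 >= 0].
    Since [|AB|^2 - |L|^2 = <AB - L, AB + L>] and [L] is an orthogonal projection
    of [AB], Cauchy-Schwarz bounds the remaining term by
    [2 |D| (E|AB - L|^2)^(1/2) (E|AB|^2)^(1/2)]. Finally [AB - L = A(S) H] with [H]
    the high part of [B], so [E|AB - L|^2 <= max|A^2| E|H|^2], and a character of
    degree at most [l] survives in [H] with probability [P(|a :&: S| > d/2)],
    which a union bound over subsets of [a] of size [k = floor(d/2) + 1] bounds by
    [(l m / n)^k]. *)

(** * Cauchy-Schwarz and Walsh expansions on the cube *)

Lemma cauchy_schwarz_sum (R : realFieldType) (I : finType) (u v : I -> R) :
  (\sum_i u i * v i) ^+ 2 <= (\sum_i u i ^+ 2) * (\sum_i v i ^+ 2).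
Proof.
(* Lagrange's identity: this double sum is twice the gap in Cauchy-Schwarz. *)
have : 0 <= \sum_i \sum_j (u i * v j - u j * v i) ^+ 2.
  by apply: sumr_ge0 => i _; apply: sumr_ge0 => j _; exact: sqr_ge0.
have -> : \sum_i \sum_j (u i * v j - u j * v i) ^+ 2 =
    2 * ((\sum_i u i ^+ 2) * (\sum_i v i ^+ 2)) - 2 * (\sum_i u i * v i) ^+ 2.
  transitivity (\sum_i \sum_j (u i ^+ 2 * v j ^+ 2 + v i ^+ 2 * u j ^+ 2
                               - 2 * ((u i * v i) * (u j * v j)))).
    by apply: eq_bigr => i _; apply: eq_bigr => j _; lra.
  rewrite (eq_bigr (fun i => u i ^+ 2 * (\sum_j v j ^+ 2)
    + v i ^+ 2 * (\sum_j u j ^+ 2) - 2 * (u i * v i * (\sum_j u j * v j)))).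
    by rewrite !big_split /= sumrN -mulr_sumr -!mulr_suml; lra.
  by move=> i _; rewrite !big_split /= sumrN -!mulr_sumr.
lra.
Qed.

(** Expanding the product over [T] only produces monomials on subsets of [T], so the degree does not
    grow. This serves to pass between bits and signs in both directions. *)
Lemma affine_substitution (R : comNzRingType) (n : nat)
    (c : {set 'I_n} -> R) (s t : R) :
  exists c' : {set 'I_n} -> R,
    (forall z : 'I_n -> R,
      \sum_T c T * \prod_(i in T) (s + t * z i) =
      \sum_T c' T * \prod_(i in T) z i) /\
    (forall k, (forall T : {set _}, (k < #|T|)%N -> c T = 0) ->
      forall T : {set _}, (k < #|T|)%N -> c' T = 0).
Proof.
(* The coefficient of the monomial on [U] in the expanded product over [T]: t^|U| s^|T \ U| if [U]
   lies in [T], and 0 otherwise. *)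
pose e (T U : {set 'I_n}) : R := \prod_i
  (if i \in U then (if i \in T then t else 0) else (if i \in T then s else 1)).
have e0 (T U : {set _}) : ~~ (U \subset T) -> e T U = 0.
  move=> /fintype.subsetPn[i iU niT].
  by rewrite /e (bigD1 i) //= iU (negbTE niT) mul0r.
exists (fun U => \sum_T c T * e T U); split.
  move=> z; under [RHS]eq_bigr do rewrite mulr_suml.
  rewrite exchange_big /=; apply: eq_bigr => T _.
  under [RHS]eq_bigr do rewrite -mulrA.
  rewrite -mulr_sumr; congr (_ * _).
  transitivity (\prod_i ((if i \in T then t else 0) * z i
                         + (if i \in T then s else 1))).
    rewrite big_mkcond /=; apply: eq_bigr => i _.
    by case: ifP => _; rewrite ?mul0r ?add0r // addrC.
  rewrite bigA_distr; apply: eq_bigr => U _.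
  rewrite /e [\prod_(i in U) _]big_mkcond /= -big_split /=.
  by apply: eq_bigr => i _; case: ifP => // _; rewrite mulr1.
move=> k ck U kU; apply: big1 => T _.
case: (boolP (U \subset T)) => [UT|/e0->]; last by rewrite mulr0.
by rewrite ck ?mul0r //; apply: (leq_trans kU); exact: subset_leq_card.
Qed.

Lemma multilinear_coef_gt_deg (R : realType) (n : nat) (f : cube n -> R)
    (T : {set _}) :
  (cube_deg f < #|T|)%N -> multilinear_coef f T = 0.
Proof.
apply: contraTeq => cT; rewrite -leqNgt.
exact: (@leq_bigmax_cond _ (fun T => multilinear_coef f T != 0)
          (fun T => #|T|)).
Qed.

Lemma multilinear_coefP (R : realType) (n : nat) (f : cube n -> R) :
  multilinear_repr f (multilinear_coef f).
Proof. by rewrite /multilinear_coef; case: cid. Qed.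

Definition walsh {R : realType} {n : nat} (a : {set 'I_n}) (x : cube n) : R :=
  \prod_(i in a) (-1) ^+ (x i).

Lemma walsh_expansion (R : realType) (n : nat) (f : cube n -> R) :
  exists c : {set 'I_n} -> R,
    (forall x, f x = \sum_a c a * walsh a x) /\
    (forall a : {set _}, (cube_deg f < #|a|)%N -> c a = 0).
Proof.
(* A bit b equals 1/2 - (-1)^b / 2. *)
have [c [cE c0]] := @affine_substitution _ _ (multilinear_coef f) (2^-1) (- 2^-1).
exists c; split; last by apply: c0 => T; exact: multilinear_coef_gt_deg.
move=> x; rewrite multilinear_coefP -cE.
apply: eq_bigr => T _; congr (_ * _); apply: eq_bigr => i _.
by case: (x i) => /=; rewrite ?expr1 ?expr0; lra.
Qed.

(** The inverse substitution (-1)^b = 1 - 2b gives a multilinear polynomial without terms above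
    degree [k]; by uniqueness its coefficients are the ones that define [cube_deg]. *)
Lemma cube_deg_walsh_sum (R : realType) (n k : nat) (f : cube n -> R)
    (c : {set 'I_n} -> R) :
  (forall x, f x = \sum_a c a * walsh a x) ->
  (forall a : {set _}, (k < #|a|)%N -> c a = 0) -> (cube_deg f <= k)%N.
Proof.
move=> fE c0; have [c' [cE' /(_ k c0) c'0]] := @affine_substitution _ _ c 1 (- 2).
have : multilinear_repr f [ffun T => c' T].
  move=> x; under eq_bigr do rewrite ffunE.
  rewrite fE -cE'; apply: eq_bigr => T _; congr (_ * _); apply: eq_bigr => i _.
  by case: (x i) => /=; rewrite ?expr1 ?expr0; lra.
move=> /(multilinear_repr_unique (multilinear_coefP R n f)) E.
apply/bigmax_leqP => T; rewrite E ffunE leqNgt; apply: contra => /c'0 ->.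
by rewrite eqxx.
Qed.

Lemma card_cube (n : nat) : #|cube n| = (2 ^ n)%N.
Proof. by rewrite card_ffun card_bool card_ord. Qed.

(** The average factors over coordinates, and a coordinate in exactly one of [a] and [b] contributes
    1 + (-1) = 0. *)
Lemma walsh_orthonormal (R : realType) (n : nat) (a b : {set 'I_n}) :
  Ex (fun x : cube n => walsh a x * walsh b x) = (a == b)%:R :> R.
Proof.
pose w (i : 'I_n) (e : bool) : R :=
  (if i \in a then (-1) ^+ e else 1) * (if i \in b then (-1) ^+ e else 1).
have -> : Ex (fun x : cube n => walsh a x * walsh b x) =
    (\prod_i \sum_(e : bool) w i e) / #|cube n|%:R.
  rewrite /Ex bigA_distr_bigA /=; congr (_ / _); apply: eq_bigr => x _.
  by rewrite /walsh /= ![\prod_(i in _) _]big_mkcond /= -big_split.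
have [ab|nab] := eqVneq a b.
  rewrite card_cube (eq_bigr (fun _ => 2)).
    by rewrite prodr_const card_ord natrX divff // expf_eq0 pnatr_eq0 andbF.
  move=> i _; rewrite big_bool /w ab /=; case: ifP => _; rewrite ?expr1 ?expr0; lra.
have [i iab] : exists i, (i \in a) != (i \in b).
  apply: contrapT => H; move/eqP: nab; apply; apply/setP => i.
  by apply/eqP/negPn/negP => ni; apply: H; exists i.
rewrite (bigD1 i) //= [X in X * _ / _](_ : _ = 0) ?mul0r //.
rewrite big_bool /w /=; move: iab.
by case: (i \in a); case: (i \in b) => //= _; rewrite ?expr1 ?expr0; lra.
Qed.

(** * Averages over finite types and Parseval's identity *)

Section Expectation.
Context {R : realType}.

Lemma eq_Ex (T : finType) (f g : T -> R) : f =1 g -> Ex f = Ex g.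
Proof. by move=> fg; rewrite /Ex (eq_bigr g). Qed.

Lemma le_Ex (T : finType) (f g : T -> R) : (forall t, f t <= g t) -> Ex f <= Ex g.
Proof.
by move=> fg; rewrite /Ex ler_wpM2r ?invr_ge0 ?ler0n //; exact: ler_sum.
Qed.

Lemma Ex_ge0 (T : finType) (f : T -> R) : (forall t, 0 <= f t) -> 0 <= Ex f.
Proof. by move=> f0; rewrite divr_ge0 ?ler0n ?sumr_ge0. Qed.

Lemma ExD (T : finType) (f g : T -> R) : Ex (fun t => f t + g t) = Ex f + Ex g.
Proof. by rewrite /Ex big_split mulrDl. Qed.

Lemma ExZ (T : finType) (c : R) (f : T -> R) : Ex (fun t => c * f t) = c * Ex f.
Proof. by rewrite /Ex -mulr_sumr mulrA. Qed.

Lemma Ex_sum (T I : finType) (f : I -> T -> R) :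
  Ex (fun t => \sum_i f i t) = \sum_i Ex (f i).
Proof. by rewrite /Ex exchange_big mulr_suml. Qed.

Lemma Ex_prod (T U : finType) (f : T -> U -> R) :
  Ex (fun tu : T * U => f tu.1 tu.2) = Ex (fun t => Ex (f t)).
Proof.
rewrite /Ex -(pair_bigA _ f) /= -mulr_suml card_prod natrM invfM -mulrA.
by rewrite [X in _ * X]mulrC.
Qed.

(** Parseval's identity: after expanding the square, orthonormality leaves only the diagonal
    terms. *)
Lemma Ex_walsh_sum_sqr (n : nat) (c : {set 'I_n} -> R) :
  Ex (fun x : cube n => (\sum_a c a * walsh a x) ^+ 2) = \sum_a c a ^+ 2.
Proof.
transitivity (Ex (fun x : cube n =>
    \sum_a \sum_b (c a * c b) * (walsh a x * walsh b x))).
  apply: eq_Ex => x; rewrite expr2 mulr_suml; apply: eq_bigr => a _.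
  by rewrite mulr_sumr; apply: eq_bigr => b _; rewrite mulrACA.
rewrite Ex_sum; apply: eq_bigr => a _; rewrite Ex_sum (bigD1 a) //= big1 => [|b ba].
  by rewrite ExZ walsh_orthonormal eqxx mulr1 addr0 expr2.
by rewrite ExZ walsh_orthonormal eq_sym (negbTE ba) mulr0.
Qed.

End Expectation.

(** * The probability that a random set meets a fixed set in many points *)

Lemma card_msubset (n m : nat) : #|{: msubset n m}| = 'C(n, m).
Proof.
rewrite card_sig -[n in RHS]card_ord -card_draws -cardsE.
by apply: eq_card => S; rewrite !inE.
Qed.

(** Complementation turns these sets into the subsets of [~: K] of size [n - m]. In this form the
    binomial vanishes by itself when [K] has more than [m] elements. *)
Lemma card_supersets (n m : nat) (K : {set 'I_n}) : (m <= n)%N ->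
  #|[set S : {set 'I_n} | (K \subset S) & (#|S| == m)]|
    = 'C(n - #|K|, n - m).
Proof.
move=> mn; have <- : #|~: K| = (n - #|K|)%N.
  by rewrite cardsCs finset.setCK card_ord.
rewrite -cards_draws -(card_imset _ (@finset.setC_inj _)).
apply: eq_card => S; rewrite inE; apply/imsetP/andP => [[U]|[SK /eqP Sm]].
  rewrite inE => /andP[KU /eqP Um] ->; rewrite finset.setCS KU; split => //.
  by rewrite cardsCs finset.setCK card_ord Um.
exists (~: S); rewrite ?finset.setCK // inE -finset.setCS finset.setCK SK.
by rewrite cardsCs finset.setCK card_ord Sm subKn // eqxx.
Qed.

(** The quotient of the two binomials is the product of (m - i)/(n - i) over i < k, and each factor
    is at most m/n. *)
Lemma bin_sub_expn_le (n m k : nat) : (m <= n)%N -> (k <= n)%N ->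
  ('C(n - k, n - m) * n ^ k <= m ^ k * 'C(n, m))%N.
Proof.
move=> mn; elim: k => [_|k IH kn].
  by rewrite subn0 expn0 muln1 mul1n bin_sub.
have := IH (ltnW kn).
have [mk|km] := leqP m k.
  by rewrite [in 'C(n - k.+1, _)]bin_small ?mul0n // ltn_sub2l // (leq_ltn_trans mk).
have key : ('C(n - k.+1, n - m) * n <= m * 'C(n - k, n - m))%N.
  have := mul_bin_down (n - k) (n - m); rewrite -subnS.
  have -> : (n - k - (n - m) = m - k)%N by lia.
  (* What remains is (m - k) n <= m (n - k), which follows from m <= n. *)
  move=> E; rewrite -(@leq_pmul2l (n - k)) ?subn_gt0 //.
  rewrite mulnA E mulnAC mulnA leq_mul2r; apply/orP; right; nia.
move=> le; rewrite !expnS.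
have -> : ('C(n - k.+1, n - m) * (n * n ^ k) = 'C(n - k.+1, n - m) * n * n ^ k)%N.
  by rewrite mulnA.
apply: leq_trans (leq_mul key (leqnn _)) _.
by rewrite -!mulnA leq_mul2l le orbT.
Qed.

Lemma bin_le_expn (n k : nat) : ('C(n, k) <= n ^ k)%N.
Proof.
apply: leq_trans (_ : n ^_ k <= _)%N; first by rewrite -bin_ffact leq_pmulr ?fact_gt0.
elim: k n => [|k IH] n; first by [].
case: n => [|n]; first by [].
rewrite ffactnSr; apply: leq_trans (leq_mul (IH _) (leq_subr _ _)) _.
by rewrite expnSr.
Qed.

Lemma card_msubset_superset (n m : nat) (K : {set 'I_n}) : (m <= n)%N ->
  #|[set S : msubset n m | K \subset val S]| = 'C(n - #|K|, n - m).
Proof.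
move=> mn; rewrite -(card_supersets _ _ _ mn) -(card_imset _ val_inj).
apply: eq_card => S; rewrite inE; apply/imsetP/andP => [[U]|[KS Sm]].
  by rewrite inE => KU ->; split => //; exact: (valP U).
by exists (exist _ S Sm); rewrite ?inE.
Qed.

(** Union bound: a set sharing at least [k] points with [a] contains some [k]-subset of [a], and
    each [k]-subset lies in C(n - k, n - m) of the sets [S]. *)
Lemma count_large_intersections (n m k : nat) (a : {set 'I_n}) : (m <= n)%N ->
  (\sum_(S : msubset n m) (k <= #|a :&: val S|) <=
     'C(#|a|, k) * 'C(n - k, n - m))%N.
Proof.
move=> mn.
apply: (@leq_trans (\sum_(S : msubset n m)
    \sum_(K : {set 'I_n} | (K \subset a) && (#|K| == k)) (K \subset val S))%N).
  apply: leq_sum => S _; apply: (@leq_trans 'C(#|a :&: val S|, k)).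
    by rewrite -(bin_gt0 _ k); case: ('C(_, _)).
  rewrite -cards_draws -sum1_card big_mkcond [leqRHS]big_mkcond /=.
  apply: leq_sum => K _; rewrite inE finset.subsetI.
  by case: (K \subset a) => //=; case: (#|K| == k); rewrite ?andbT ?andbF //;
    case: (K \subset _).
rewrite exchange_big /= (eq_bigr (fun _ => 'C(n - k, n - m))).
  by rewrite sum_nat_const -[X in (X * _)%N]cardsE cards_draws.
move=> K /andP[_ /eqP Kk]; rewrite -Kk -card_msubset_superset //.
by rewrite -sum1_card [RHS]big_mkcond; apply: eq_bigr => S _; rewrite inE; case: ifP.
Qed.

Lemma prob_large_intersection (R : realType) (n m l k : nat) (a : {set 'I_n}) :
  (m < n)%N -> (k <= n)%N -> (#|a| <= l)%N ->
  Ex (fun S : msubset n m => (k <= #|a :&: val S|)%N%:R)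
    <= (l%:R * m%:R / (n%:R - m%:R)) ^+ k :> R.
Proof.
move=> mn kn al; have n0 : (0 < n)%N by apply: leq_ltn_trans mn.
have C0 : 0 < 'C(n, m)%:R :> R by rewrite ltr0n bin_gt0 ltnW.
have nm0 : 0 < n%:R - m%:R :> R by rewrite subr_gt0 ltr_nat.
have n0R : 0 < n%:R :> R by rewrite ltr0n.
rewrite /Ex card_msubset ler_pdivrMr // -natr_sum.
(* Counting gives the sharper denominator n; it is then weakened to n - m. *)
apply: (@le_trans _ _ ((l%:R * m%:R / n%:R) ^+ k * 'C(n, m)%:R)).
  rewrite expr_div_n mulrAC ler_pdivlMr ?exprn_gt0 //.
  rewrite -!natrM -!natrX -!natrM ler_nat expnMn.
  apply: leq_trans (leq_mul (count_large_intersections _ _ k a (ltnW mn)) (leqnn _)) _.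
  rewrite -mulnA -[leqRHS]mulnA leq_mul //; last exact: bin_sub_expn_le (ltnW mn) kn.
  apply: leq_trans (bin_le_expn _ _) _.
  by case: (posnP k) => [->|k0]; rewrite ?expn0 ?leq_exp2r.
apply: ler_wpM2r; first exact: ltW.
apply: lerXn2r; rewrite ?nnegrE ?divr_ge0 ?mulr_ge0 ?ler0n // ?(ltW nm0) //.
rewrite ler_wpM2l ?mulr_ge0 ?ler0n // lef_pV2 ?posrE //.
by rewrite lerBlDr lerDl ler0n.
Qed.

(** * Resampling the coordinates in S *)

Section Glue.
Context {n m : nat} (S : msubset n m).

Lemma msubset_elt_inj : injective (msubset_elt S).
Proof. by move=> j k /enum_val_inj /cast_ord_inj. Qed.

Lemma msubset_eltP (i : 'I_n) :
  reflect (exists k, msubset_elt S k = i) (i \in val S).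
Proof.
apply: (iffP idP) => [iS|[k <-]]; last exact: enum_valP.
exists (cast_ord (eqP (valP S)) (enum_rank_in iS i)).
by rewrite /msubset_elt cast_ordK enum_rankK_in.
Qed.

(** Overwriting x on S by an independent y lets the pseudo-density condition be applied in y while
    the coordinates outside S stay fixed. *)
Definition glue (x : cube n) (y : cube m) : cube n :=
  [ffun i => if [pick k | msubset_elt S k == i] is Some k then y k else x i].

Lemma glue_in x y k : glue x y (msubset_elt S k) = y k.
Proof.
rewrite ffunE; case: pickP => [j /eqP /msubset_elt_inj -> //|/(_ k)].
by rewrite eqxx.
Qed.

Lemma glue_out x y i : i \notin val S -> glue x y i = x i.
Proof.
move=> iS; rewrite ffunE; case: pickP => // k /eqP E.
by case/negP: iS; apply/msubset_eltP; exists k.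
Qed.

Lemma restr_glue x y : restr (glue x y) S = y.
Proof. by apply/ffunP => k; rewrite ffunE glue_in. Qed.

Lemma glue_restr x y : glue (glue x y) (restr x S) = x.
Proof.
apply/ffunP => i; case: (boolP (i \in val S)) => [/msubset_eltP[k <-]|iS].
  by rewrite glue_in ffunE.
by rewrite !glue_out.
Qed.

(* [(x, y) |-> (glue x y, restr x S)] is an involution. *)
Lemma Ex_glue (R : realType) (f : cube n -> R) :
  Ex f = Ex (fun x => Ex (fun y => f (glue x y))).
Proof.
rewrite -(Ex_prod _ _ (fun x y => f (glue x y))).
transitivity (Ex (fun xy : cube n * cube m => f xy.1)).
  rewrite (Ex_prod _ _ (fun x _ => f x)); apply: eq_Ex => x.
  by rewrite /Ex sumr_const -(mulr_natr (f x)) mulfK // card_cube pnatr_eq0 expn_eq0.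
rewrite /Ex; congr (_ / _).
pose h (xy : cube n * cube m) := (glue xy.1 xy.2, restr xy.1 S).
have hK : involutive h by case=> x y; rewrite /h /= glue_restr restr_glue.
by rewrite (reindex_inj (inv_inj hK)).
Qed.

(** The part of [a] inside S, re-indexed by positions in x_S, so that it indexes a character on the
    small cube. *)
Definition trace (a : {set 'I_n}) : {set 'I_m} :=
  [set k | msubset_elt S k \in a].

Lemma imset_trace a : [set msubset_elt S k | k in trace a] = a :&: val S.
Proof.
apply/setP => i; rewrite !inE; apply/imsetP/andP => [[k]|[ia /msubset_eltP[k ki]]].
  by rewrite inE => ka ->; split => //; apply/msubset_eltP; exists k.
by exists k; rewrite // inE ki.
Qed.

Lemma card_trace a : #|trace a| = #|a :&: val S|.
Proof. by rewrite -imset_trace card_imset //; exact: msubset_elt_inj. Qed.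

Lemma walsh_glue (R : realType) a x y :
  walsh a (glue x y) = walsh (a :\: val S) x * walsh (trace a) y :> R.
Proof.
rewrite /walsh (big_setID (val S)) /= -imset_trace big_imset /=; last first.
  by move=> j k _ _; exact: msubset_elt_inj.
rewrite mulrC; congr (_ * _); apply: eq_bigr => i; last by rewrite glue_in.
by rewrite inE => /andP[iS _]; rewrite glue_out.
Qed.

(** For each fixed x, the sum is a function of the resampled y of degree at most [d./2], so the
    inner average is nonnegative. *)
Lemma pseudo_density_restr (R : realType) (d : nat) (D : cube m -> R)
    (c : {set 'I_n} -> R) :
  pseudo_density d D -> (forall a : {set _}, (d./2 < #|a :&: val S|)%N -> c a = 0) ->
  0 <= Ex (fun x => D (restr x S) * (\sum_a c a * walsh a x) ^+ 2).
Proof.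
move=> [_ D0] c0; rewrite Ex_glue; apply: Ex_ge0 => x.
under eq_Ex => y do rewrite restr_glue.
apply: D0; apply: (@le_trans _ _ d./2%:R).
  (* All [a] with the same trace [b] merge into one character of y, whose coefficient depends only
     on the fixed x. *)
  rewrite ler_nat; apply: (@cube_deg_walsh_sum _ _ _ _
    (fun b => \sum_(a | trace a == b) c a * walsh (a :\: val S) x)).
    move=> y; rewrite (partition_big trace xpredT) //=; apply: eq_bigr => b _.
    rewrite mulr_suml; apply: eq_bigr => a /eqP <-.
    by rewrite walsh_glue mulrA.
  move=> b kb; apply: big1 => a /eqP ab; rewrite c0 ?mul0r //.
  by rewrite -card_trace ab.
rewrite ler_pdivlMr // -natrM ler_nat muln2 -[leqRHS]odd_double_half leq_addl //.
Qed.

End Glue.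

(** * Frobenius and operator norms *)

Lemma frobenius_sqr (R : realType) (p q : nat) (M : 'M[R]_(p, q)) :
  frobenius_norm M ^+ 2 = \sum_i \sum_j M i j ^+ 2.
Proof.
rewrite sqr_sqrtr //.
by apply: sumr_ge0 => i _; apply: sumr_ge0 => j _; exact: sqr_ge0.
Qed.

Lemma frobenius_ge0 (R : realType) (p q : nat) (M : 'M[R]_(p, q)) :
  0 <= frobenius_norm M.
Proof. exact: sqrtr_ge0. Qed.

Lemma frobenius_cV_sqr (R : realType) (p : nat) (v : 'cV[R]_p) :
  frobenius_norm v ^+ 2 = \sum_i v i 0 ^+ 2.
Proof. by rewrite frobenius_sqr; apply: eq_bigr => i _; rewrite big_ord1. Qed.

Lemma frobenius_eq0 (R : realType) (p q : nat) (M : 'M[R]_(p, q)) :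
  frobenius_norm M = 0 -> M = 0.
Proof.
move=> M0; have := frobenius_sqr _ _ _ M; rewrite M0 expr0n /= => /esym /eqP.
rewrite psumr_eq0; last by move=> i _; apply: sumr_ge0 => j _; exact: sqr_ge0.
move=> /allP H; apply/matrixP => i j; rewrite mxE.
have := H i (mem_index_enum _); rewrite psumr_eq0; last by move=> k _; exact: sqr_ge0.
by move=> /allP /(_ j (mem_index_enum _)); rewrite /= sqrf_eq0 => /eqP.
Qed.

Lemma frobeniusZ (R : realType) (p q : nat) (t : R) (M : 'M[R]_(p, q)) :
  0 <= t -> frobenius_norm (t *: M) = t * frobenius_norm M.
Proof.
move=> t0; rewrite /frobenius_norm -{2}(ger0_norm t0) -sqrtr_sqr -sqrtrM ?sqr_ge0 //.
rewrite mulr_sumr; congr Num.sqrt; apply: eq_bigr => i _.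
by rewrite mulr_sumr; apply: eq_bigr => j _; rewrite mxE exprMn.
Qed.

Lemma frobenius_mulmx_cV (R : realType) (p q : nat) (M : 'M[R]_(p, q)) (v : 'cV_q) :
  frobenius_norm (M *m v) <= operator_norm M * frobenius_norm v.
Proof.
(* A nonzero vector is rescaled to norm 1, so that it enters the supremum; the zero vector is
   treated apart. *)
have [v0|v0] := eqVneq (frobenius_norm v) 0.
  by rewrite v0 (frobenius_eq0 _ _ _ _ v0) mulmx0 -(scale0r (0 : 'cV[R]_p))
    frobeniusZ // mul0r mulr0.
have vgt0 : 0 < frobenius_norm v by rewrite lt_neqAle eq_sym v0 frobenius_ge0.
rewrite -ler_pdivrMr // mulrC -frobeniusZ ?invr_ge0 ?frobenius_ge0 // scalemxAr.
apply: ub_le_sup; first by case: (operator_norm_has_sup M).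
exists ((frobenius_norm v)^-1 *: v) => //=.
by rewrite frobeniusZ ?invr_ge0 ?frobenius_ge0 // mulVf.
Qed.

(* [|A v|^2 = <v, A^2 v>], which is at most [|v| |A^2 v|]. *)
Lemma frobenius_symmetric_mulmx (R : realType) (p q : nat) (A : 'M[R]_p)
    (M : 'M[R]_(p, q)) :
  A^T = A ->
  frobenius_norm (A *m M) ^+ 2 <= operator_norm (A *m A) * frobenius_norm M ^+ 2.
Proof.
move=> AT; have col_le (v : 'cV[R]_p) :
    frobenius_norm (A *m v) ^+ 2 <= operator_norm (A *m A) * frobenius_norm v ^+ 2.
  have E : frobenius_norm (A *m v) ^+ 2 = \sum_k v k 0 * (A *m A *m v) k 0.
    transitivity (((A *m v)^T *m (A *m v)) 0 0).
      by rewrite frobenius_cV_sqr mxE; apply: eq_bigr => i _; rewrite [(_^T) _ _]mxE expr2.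
    rewrite trmx_mul AT -(mulmxA v^T) (mulmxA A A v) mxE.
    by apply: eq_bigr => k _; rewrite [(v^T) _ _]mxE.
  apply: (@le_trans _ _ (frobenius_norm v * frobenius_norm (A *m A *m v))).
    rewrite E; apply: le_trans (ler_norm _) _; rewrite -sqrtr_sqr.
    rewrite -[leRHS]ger0_norm ?mulr_ge0 ?frobenius_ge0 // -sqrtr_sqr.
    apply: ler_wsqrtr; rewrite exprMn !frobenius_cV_sqr.
    exact: cauchy_schwarz_sum.
  rewrite expr2 mulrCA ler_wpM2l ?frobenius_ge0 //.
  exact: frobenius_mulmx_cV.
(* The squared Frobenius norm is additive over columns, which reduces the claim to vectors. *)
have sqrE (N : 'M[R]_(p, q)) :
    frobenius_norm N ^+ 2 = \sum_j frobenius_norm (col j N) ^+ 2.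
  rewrite frobenius_sqr exchange_big /=; apply: eq_bigr => j _.
  by rewrite frobenius_cV_sqr; apply: eq_bigr => i _; rewrite mxE.
rewrite !sqrE mulr_sumr; apply: ler_sum => j _.
by rewrite colE -mulmxA -colE; exact: col_le.
Qed.

(** * The weighted second-moment estimate and the exponent d/2 *)

Lemma Ex_weighted_sqr_ge (R : realType) (T I : finType) (W : T -> R) (M : R)
    (F L : T -> I -> R) :
  0 <= M -> (forall t, `|W t| <= M) ->
  0 <= Ex (fun t => W t * \sum_i L t i ^+ 2) ->
  Ex (fun t => \sum_i L t i ^+ 2) <= Ex (fun t => \sum_i F t i ^+ 2) ->
  - (2 * M * Num.sqrt (Ex (fun t => \sum_i (F t i - L t i) ^+ 2))
           * Num.sqrt (Ex (fun t => \sum_i F t i ^+ 2)))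
  <= Ex (fun t => W t * \sum_i F t i ^+ 2).
Proof.
move=> M0 WM L0 LF.
set h := Ex (fun t => \sum_i (F t i - L t i) ^+ 2).
set f := Ex (fun t => \sum_i F t i ^+ 2).
have sum0 (G : T -> I -> R) : 0 <= Ex (fun t => \sum_i G t i ^+ 2).
  by apply: Ex_ge0 => t; apply: sumr_ge0 => i _; exact: sqr_ge0.
have h0 : 0 <= h by exact: (sum0 (fun t i => F t i - L t i)).
have f0 : 0 <= f by exact: sum0.
pose X := Ex (fun t => \sum_i (F t i - L t i) * (W t * (F t i + L t i))).
(* F^2 = L^2 + (F - L)(F + L); the first term has nonnegative weighted average by hypothesis. *)
have -> : Ex (fun t => W t * \sum_i F t i ^+ 2) =
    Ex (fun t => W t * \sum_i L t i ^+ 2) + X.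
  rewrite -ExD; apply: eq_Ex => t; rewrite !mulr_sumr -big_split /=.
  by apply: eq_bigr => i _; rewrite !expr2; lra.
suff : - X <= 2 * M * Num.sqrt h * Num.sqrt f by lra.
apply: le_trans (ler_norm _) _; rewrite normrN -sqrtr_sqr.
have -> : 2 * M * Num.sqrt h * Num.sqrt f = Num.sqrt (h * ((2 * M) ^+ 2 * f)).
  rewrite [Num.sqrt (h * _)]sqrtrM // [Num.sqrt (_ ^+ 2 * _)]sqrtrM ?sqr_ge0 //.
  rewrite sqrtr_sqr ger0_norm ?mulr_ge0 //; lra.
apply: ler_wsqrtr.
have sqE (G : T -> I -> R) : Ex (fun t => \sum_i G t i) =
    (\sum_(ti : T * I) G ti.1 ti.2) / #|T|%:R.
  by rewrite /Ex pair_bigA.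
(* Cauchy-Schwarz over the pairs [(t, i)], with the weight attached to F + L. *)
apply: (@le_trans _ _ (h * Ex (fun t => \sum_i (W t * (F t i + L t i)) ^+ 2))).
  rewrite /X /h !sqE exprMn [leRHS]mulrACA -[X in _ <= _ * X]expr2.
  by rewrite ler_wpM2r ?sqr_ge0 //; exact: cauchy_schwarz_sum.
rewrite ler_wpM2l //.
(* (F + L)^2 <= 2 F^2 + 2 L^2, and the second moment of L is at most that of F; the resulting 4 is
   the square of the constant 2 in the bound. *)
apply: (@le_trans _ _ (M ^+ 2 * (2 * f + 2 * Ex (fun t => \sum_i L t i ^+ 2)))).
  rewrite -!ExZ -ExD -ExZ; apply: le_Ex => t.
  rewrite !mulr_sumr -big_split mulr_sumr /=; apply: ler_sum => i _.
  rewrite exprMn ler_pM ?sqr_ge0 //.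
    by rewrite -[X in X <= _]real_normK ?num_real // lerXn2r ?nnegrE.
  by have := sqr_ge0 (F t i - L t i); lra.
have -> : (2 * M) ^+ 2 * f = M ^+ 2 * (4 * f) by rewrite exprMn; lra.
apply: ler_wpM2l; first exact: sqr_ge0.
by rewrite -/f in LF; lra.
Qed.

(** If the base is at least 1, the bound is at least 1 and any probability satisfies it. Otherwise
    the integer exponent [d./2 + 1] may be lowered to d/2. *)
Lemma prob_large_intersection_powR (R : realType) (n m l d : nat) (a : {set 'I_n}) :
  (m < n)%N -> (d./2 < n)%N -> (#|a| <= l)%N ->
  Ex (fun S : msubset n m => (d./2 < #|a :&: val S|)%N%:R)
    <= (l%:R * m%:R / (n%:R - m%:R)) `^ (d%:R / 2) :> R.
Proof.
move=> mn dn al; set r : R := _ / _.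
have r0 : 0 <= r by rewrite divr_ge0 ?mulr_ge0 ?ler0n // subr_ge0 ler_nat ltnW.
have d0 : 0 <= d%:R / 2 :> R by rewrite divr_ge0 ?ler0n.
have [r1|r1] := leP 1 r.
  apply: (@le_trans _ _ 1); last by have := ler_powR r1 d0; rewrite powRr0.
  rewrite /Ex ler_pdivrMr ?mul1r; last by rewrite ltr0n card_msubset bin_gt0 ltnW.
  rewrite -natr_sum ler_nat -sum1_card; apply: leq_sum => S _; exact: leq_b1.
apply: le_trans (prob_large_intersection _ _ _ _ _ _ mn dn al) _; rewrite -/r.
(* At base 0, [powR] is not given by exp and ln; the left side is 0 because its exponent is
   positive. *)
have [->|rn0] := eqVneq r 0; first by rewrite expr0n /= powR_ge0.
rewrite -powR_mulrn //.
have rgt0 : 0 < r by rewrite lt_neqAle eq_sym rn0.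
rewrite /powR (negbTE rn0) ler_expR ler_wnM2r ?ln_le0 ?(ltW r1) //.
rewrite ler_pdivrMr // -natrM ler_nat; lia.
Qed.

(** * Truncation of A(S)B(x) and assembly of the bound *)

Theorem theorem3p5 (R : realType) (n m d l p : nat)
  (hn : (1 <= n)%N)
  (hm : (0 < m)%N) (hmn : (m < n)%N)
  (hd : (0 < d)%N) (hdn : (d <= n)%N)
  (hl : (0 < l)%N) (hln : (l <= n)%N)
  (A : msubset n m -> 'M[R]_p)
  (B : cube n -> 'M[R]_p)
  (D : cube m -> R)
  (hA : forall S, (A S)^T = A S)
  (hB : forall x, (B x)^T = B x)
  (hD : pseudo_density d D)
  (hdegB : (mx_cube_deg B <= l)%N) :
  Ex (fun Sx : msubset n m * cube n =>
        D (restr Sx.2 Sx.1) * frobenius_norm (A Sx.1 *m B Sx.2) ^+ 2)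
  >= - (2 * sup_norm D
        * ((l%:R * m%:R / (n%:R - m%:R)) `^ (d%:R / 4))
        * Num.sqrt (\big[Num.max/0]_(S : msubset n m) operator_norm (A S *m A S))
        * Num.sqrt (Ex (fun Sx : msubset n m * cube n =>
                          frobenius_norm (A Sx.1 *m B Sx.2) ^+ 2))
        * Num.sqrt (Ex (fun x : cube n => frobenius_norm (B x) ^+ 2))).

Proof.
have BE (q : 'I_p * 'I_p) : exists c : {set 'I_n} -> R,
    (forall x, B x q.1 q.2 = \sum_a c a * walsh a x) /\
    (forall a : {set _}, (l < #|a|)%N -> c a = 0).
  have [c [cE c0]] := walsh_expansion R n (fun x => B x q.1 q.2).
  exists c; split=> // a la; apply: c0; apply: leq_ltn_trans la.
  apply: leq_trans hdegB; rewrite /mx_cube_deg.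
  apply: leq_trans (leq_bigmax q.1); exact: (leq_bigmax q.2).
have [b bP] := boolp.choice BE.
pose low (S : msubset n m) (a : {set 'I_n}) := (#|a :&: val S| <= d./2)%N.
(* [e S q] holds the Walsh coefficients of entry [q] of A(S)B(x), [L] keeps the low ones, and [H] is
   the high part of B alone. *)
pose e S (q : 'I_p * 'I_p) a := \sum_k A S q.1 k * b (k, q.2) a.
pose F (t : msubset n m * cube n) q := (A t.1 *m B t.2) q.1 q.2.
pose L (t : msubset n m * cube n) q :=
  \sum_a (if low t.1 a then e t.1 q a else 0) * walsh a t.2.
pose H S x : 'M[R]_p :=
  \matrix_(i, j) \sum_a (if low S a then 0 else b (i, j) a) * walsh a x.
have FE t q : F t q = \sum_a e t.1 q a * walsh a t.2.
  rewrite /F mxE; under eq_bigr => k _ do rewrite (bP (k, q.2)).1 mulr_sumr.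
  rewrite exchange_big; apply: eq_bigr => a _; rewrite mulr_suml.
  by apply: eq_bigr => k _; rewrite mulrA.
(* For fixed S, truncation in x commutes with left multiplication by A(S). *)
have FL t q : F t q - L t q = (A t.1 *m H t.1 t.2) q.1 q.2.
  rewrite FE /L -sumrB mxE; under [RHS]eq_bigr => k _ do rewrite mxE mulr_sumr.
  rewrite exchange_big; apply: eq_bigr => a _; rewrite -mulrBl.
  under [RHS]eq_bigr do rewrite mulrA.
  rewrite -mulr_suml; congr (_ * _); case: ifP => _; last by rewrite subr0.
  by rewrite subrr big1 // => k _; rewrite mulr0.
have frobE (M : 'M[R]_p) :
    frobenius_norm M ^+ 2 = \sum_(q : 'I_p * 'I_p) M q.1 q.2 ^+ 2.
  by rewrite frobenius_sqr pair_bigA.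
set r : R := _ / (_ - _); set NB := Ex (fun x => frobenius_norm (B x) ^+ 2).
set MA : R := \big[Num.max/0]_S _.
have MA0 : 0 <= MA by apply: bigmax_ge_id.
have NH : Ex (fun t => \sum_q (F t q - L t q) ^+ 2) <= MA * (r `^ (d%:R / 2) * NB).
  apply: (@le_trans _ _ (MA * Ex (fun t : msubset n m * cube n =>
                                    frobenius_norm (H t.1 t.2) ^+ 2))).
    rewrite -ExZ; apply: le_Ex => t.
    under eq_bigr do rewrite FL.
    rewrite -frobE; apply: le_trans (frobenius_symmetric_mulmx _ _ _ _ _ (hA _)) _.
    by rewrite ler_wpM2r ?sqr_ge0 //; apply: le_bigmax.
  rewrite ler_wpM2l //.
  have -> : NB = \sum_q \sum_a b q a ^+ 2.
    rewrite /NB; under eq_Ex => x do rewrite frobE.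
    rewrite Ex_sum; apply: eq_bigr => q _; rewrite -Ex_walsh_sum_sqr.
    by apply: eq_Ex => x; rewrite (bP q).1.
  rewrite (Ex_prod _ _ (fun S x => frobenius_norm (H S x) ^+ 2)).
  (* Parseval for fixed S; averaging over S then turns each indicator into the probability that [a]
     is high. *)
  have -> : Ex (fun S => Ex (fun x => frobenius_norm (H S x) ^+ 2)) =
      Ex (fun S => \sum_q \sum_a (~~ low S a)%:R * b q a ^+ 2).
    apply: eq_Ex => S; under eq_Ex => x do rewrite frobE.
    rewrite Ex_sum; apply: eq_bigr => q _.
    under eq_Ex => x do rewrite mxE.
    rewrite Ex_walsh_sum_sqr; apply: eq_bigr => a _.
    by case: (low S a); rewrite ?expr0n ?mul0r ?mul1r -?surjective_pairing.
  rewrite Ex_sum mulr_sumr; apply: ler_sum => q _.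
  rewrite Ex_sum mulr_sumr; apply: ler_sum => a _.
  under eq_Ex do rewrite mulrC; rewrite ExZ mulrC.
  (* Coefficients above degree [l] vanish, so the probability bound is only used for sets of size at
     most [l]. *)
  have [al|la] := leqP #|a| l; last by rewrite (bP q).2 // expr0n !mulr0.
  rewrite ler_wpM2r ?sqr_ge0 //; under eq_Ex do rewrite /low -ltnNge.
  by apply: prob_large_intersection_powR => //; lia.
have NF : Ex (fun t : msubset n m * cube n => frobenius_norm (A t.1 *m B t.2) ^+ 2)
    = Ex (fun t => \sum_q F t q ^+ 2).
  by apply: eq_Ex => t; rewrite frobE.
have DF : Ex (fun t : msubset n m * cube n =>
      D (restr t.2 t.1) * frobenius_norm (A t.1 *m B t.2) ^+ 2)
    = Ex (fun t : msubset n m * cube n => D (restr t.2 t.1) * \sum_q F t q ^+ 2).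
  by apply: eq_Ex => t; rewrite frobE.
rewrite DF NF.
have D0 : 0 <= sup_norm D by apply: bigmax_ge_id.
(* The weight is D(x_S), bounded by its sup norm; the side conditions are handled first. *)
apply: le_trans (Ex_weighted_sqr_ge _ _ _ _ _ F L D0 _ _ _); first last.
(* By Parseval, dropping coefficients can only lower the second moment. *)
- rewrite (Ex_prod _ _ (fun S x => \sum_q L (S, x) q ^+ 2)).
  rewrite (Ex_prod _ _ (fun S x => \sum_q F (S, x) q ^+ 2)).
  apply: le_Ex => S; rewrite !Ex_sum; apply: ler_sum => q _.
  under [leRHS]eq_Ex do rewrite FE.
  rewrite /L /= !Ex_walsh_sum_sqr; apply: ler_sum => a _.
  by case: ifP => // _; rewrite expr0n sqr_ge0.
- rewrite (Ex_prod _ _ (fun S x => D (restr x S) * \sum_q L (S, x) q ^+ 2)).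
  apply: Ex_ge0 => S; under eq_Ex do rewrite mulr_sumr.
  rewrite Ex_sum; apply: sumr_ge0 => q _.
  apply: (pseudo_density_restr S R d D
    (fun a => if low S a then e S q a else 0)) => // a da.
  by rewrite /low leqNgt da.
- by move=> t; apply: le_bigmax.
(* The square root halves the exponent d/2 to d/4. *)
have sqrtNH : Num.sqrt (Ex (fun t => \sum_q (F t q - L t q) ^+ 2)) <=
    r `^ (d%:R / 4) * Num.sqrt MA * Num.sqrt NB.
  apply: le_trans (ler_wsqrtr NH) _; rewrite sqrtrM // sqrtrM ?powR_ge0 //.
  have -> : d%:R / 2 = d%:R / 4 * 2 :> R by lra.
  by rewrite powRrM powR_mulrn ?powR_ge0 // sqrtr_sqr ger0_norm ?powR_ge0 // mulrCA mulrA.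
set f := Num.sqrt (Ex (fun t => \sum_q F t q ^+ 2)).
have f0 : 0 <= f by exact: sqrtr_ge0.
rewrite lerN2.
have -> : 2 * sup_norm D * r `^ (d%:R / 4) * Num.sqrt MA * f * Num.sqrt NB =
  2 * sup_norm D * (r `^ (d%:R / 4) * Num.sqrt MA * Num.sqrt NB) * f by lra.
by rewrite ler_wpM2r // ler_wpM2l // mulr_ge0.
Qed.
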